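(* Let $w$ be an infinite word over $\Sigma=\{0,\dots,\sigma-1\}$ generated by a morphism $\phi$. Then $w$ satisfies the WELLDOC property if and only if $\det A_\phi=\pm1$ and the Parikh vectors of all returns to the first letter of $w$ generate $\mathbb{Z}^{\sigma}$ as an additive group.
   Context: A morphism $\phi:\Sigma^*\to\Sigma^*$ is nonerasing; an infinite word $w$ is generated by $\phi$ if $\phi(a)=as$ for a letter $a$ and a nonempty word $s$, and $w=\lim_{n\to\infty}\phi^n(a)$. The matrix $A_\phi$ is the $\sigma\times\sigma$ integer matrix whose entry in row $j$, column $i$ is $|\phi(i)|_j$. The Parikh vector of a finite word $u$ is $V_u=(|u|_0,\dots,|u|_{\sigma-1})$. For a factor $u$ of $w$ occurring at positions $a_0<a_1<\dots$, let $X_u=\{V_{w[0,a_i)}\}$ and $X_{u,m}$ its reduction modulo $m$; $w$ satisfies WELLDOC if $X_{u,m}=(\mathbb{Z}/m\mathbb{Z})^\sigma$ for every $m\ge1$ and every factor $u$. A return to $u$ is a factor $w[a_i,a_{i+1})$ between consecutive occurrences of $u$.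
   Formalization: The alphabet is assumed to have at least two letters (σ ≥ 2), since for σ = 1 the claim always fails: e.g. φ(0)=00 generates 000…, which satisfies WELLDOC although det A_φ = 2. *)

(* Defs.v *)
(* Letters are 'I_sigma, finite words are seq 'I_sigma and
   infinite words are functions nat -> 'I_sigma. *)
From HB Require Import structures.
From mathcomp Require Import all_boot all_order all_algebra.

Set Implicit Arguments.
Unset Strict Implicit.
Unset Printing Implicit Defensive.

Import GRing.Theory.
Local Open Scope ring_scope.

Section Words.
Variable sigma : nat.
Local Notation letter := 'I_sigma.
Local Notation word := (seq 'I_sigma).
Implicit Types (u r : word) (w : nat -> letter) (phi : word -> word).

(* Nonerasing endomorphisms of the free monoid; phi [::] = [::] follows from
   compatibility with concatenation. *)
Definition is_morphism phi : Prop :=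
  {morph phi : u v / u ++ v} /\ (forall a : letter, phi [:: a] <> [::]).

(* w[i, j) *)
Definition slice w (i j : nat) : word := [seq w k | k <- index_iota i j].

(* Limits in the topology of finite and infinite words: every prefix of w is
   eventually a prefix of x n. *)
Definition word_lim (x : nat -> word) w : Prop :=
  forall k, exists N, forall n, (N <= n)%N -> prefix (slice w 0 k) (x n).

Definition generated_by phi w : Prop :=
  exists a : letter, exists s : word,
    [/\ phi [:: a] = a :: s, s <> [::] &
        word_lim (fun n => iter n phi [:: a]) w].

Definition incidence_mx phi : 'M[int]_sigma :=
  \matrix_(j < sigma, i < sigma) (count_mem j (phi [:: i]))%:Z.

Definition parikh u : 'rV[int]_sigma :=
  \row_(j < sigma) (count_mem j u)%:Z.

Definition occurs_at w u (i : nat) : Prop := slice w i (i + size u) = u.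

Definition factor w u : Prop := exists i, occurs_at w u i.

(* The set X_u. *)
Definition prefix_parikh w u (x : 'rV[int]_sigma) : Prop :=
  exists2 i, occurs_at w u i & x = parikh (slice w 0 i).

Definition eq_mod (m : nat) (x y : 'rV[int]_sigma) : Prop :=
  forall j, (x 0%R j = y 0%R j %[mod m])%Z.

(* (Z/mZ)^sigma is handled through representatives in Z^sigma (in MathComp
   'Z_1 is not the trivial ring): X_u reduces onto (Z/mZ)^sigma when every
   class modulo m contains an element of X_u. *)
Definition welldoc w : Prop :=
  forall (m : nat) u, (1 <= m)%N -> factor w u ->
  forall v : 'rV[int]_sigma, exists2 x, prefix_parikh w u x & eq_mod m x v.

Definition is_return w u r : Prop :=
  exists i j : nat,
    [/\ (i < j)%N, occurs_at w u i, occurs_at w u j,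
        (forall k, (i < k < j)%N -> ~ occurs_at w u k) & r = slice w i j].

End Words.

(* The subgroup generated by S, i.e. the intersection of all subgroups
   containing S, is the whole of V. *)
Definition generates (V : zmodType) (S : V -> Prop) : Prop :=
  forall H : V -> Prop,
    H 0 -> (forall x y, H x -> H y -> H (x - y)) ->
    (forall x, S x -> H x) ->
  forall v, H v.

(* Main.v *)
(** Write B for the transpose of the incidence matrix, so that
    V_{phi(u)} = V_u B, let a be the first letter of w, and L_N = |phi^N(a)|.

    Sufficiency. Every factor u occurs in some phi^N(a), hence in the image of
    each occurrence of a, and X_u contains X_a B^N + c; so only X_a matters. If
    B^n = 1 mod m with n large, placing a prefix of phi^n(a) after
    phi^n(w[0,i)), w_i = a, shows that X_a mod m is closed under addition. It is
    thus a subgroup, and it contains the Parikh vectors of the returns.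

    Necessity of the generation condition. The subgroup generated by the
    returns contains X_a, so it surjects modulo every m; such a subgroup of
    Z^sigma is everything.

    Necessity of det = +-1. There is a prefix u of w of length O(L_N) such that
    each of its occurrences in w contains an image phi^N(a) cut along the
    factorization of w by phi^N; so X_u is covered by translates of the image of
    B^N, one for each position of the prefix phi^N(a) of w inside u. If det B is
    not +-1 the number of cosets needed grows at least like 2^N, hence phi^N(a)
    overlaps itself with a shift that is small with respect to L_N, i.e. it has
    a relatively short period. Since L_{N+1} = O(L_N), two consecutive periods
    coexist on a long enough word to force w itself to be periodic, and the
    prefixes of a periodic word reach too few classes modulo m. *)
Require Import Defs.
From Stdlib Require Import Classical.
From mathcomp Require Import all_boot all_order all_algebra.
From mathcomp Require Import zify ring.

Set Implicit Arguments.
Unset Strict Implicit.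
Unset Printing Implicit Defensive.

Import Order.TTheory GRing.Theory Num.Theory.
Local Open Scope ring_scope.

(** * Congruences, images of integer matrices and subgroups of Z^s *)

Section IntegerMatrices.
Variable s : nat.
Implicit Types (x y z v : 'rV[int]_s) (B : 'M[int]_s) (m : nat).

Lemma eq_modP m x y :
  eq_mod m x y <-> exists z, x = y + m%:Z *: z.
Proof.
split=> [xy | [z ->] j]; last first.
  by rewrite !mxE addrC mulrC modzMDl.
exists (\row_j ((x 0%R j - y 0%R j) %/ m)%Z).
apply/rowP=> j; rewrite !mxE.
have /eqP := xy j; rewrite eqz_mod_dvd => /divzK d.
by rewrite mulrC d addrC subrK.
Qed.

(** The witness is [z *m \adj B] up to sign. Hence vectors divisible by the determinant lie in the
    image of [B]. *)
Lemma absdet_image B z : exists y, `|\det B|%N%:Z *: z = y *m B.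
Proof.
have d : \det B *: z = (z *m \adj B) *m B.
  by rewrite -mulmxA mul_adj_mx mul_mx_scalar.
have [le|lt] := lerP 0 (\det B).
  by exists (z *m \adj B); rewrite abszE ger0_norm.
exists (- z *m \adj B); rewrite abszE ltr0_norm //.
by rewrite !mulNmx -d scaleNr.
Qed.

Lemma det_unitmx B : \det B = 1 \/ \det B = -1 -> B \in unitmx.
Proof. by rewrite unitmxE => -[] ->; rewrite ?unitrN unitr1. Qed.

Lemma unitmx_det B : B \in unitmx -> \det B = 1 \/ \det B = -1.
Proof.
by rewrite unitmxE => /orP[] /eqP ->; [left | right].
Qed.

Lemma unitmx_exp B n : B \in unitmx -> B ^+ n \in unitmx.
Proof.
by move=> uB; elim: n => [|n IH]; rewrite ?unitmx1 // exprS unitmx_mul uB.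
Qed.

(** By pigeonhole two powers of [B] have the same reduction modulo [m]; invertibility cancels the
    smaller one. *)
Lemma mod_order m B : (0 < m)%N -> B \in unitmx ->
  exists2 n, (0 < n)%N & forall x, eq_mod m (x *m B ^+ n) x.
Proof.
case: m => // m _ uB.
pose T := {ffun 'I_s * 'I_s -> 'I_m.+1}.
pose g (i : 'I_#|T|.+1) : T :=
  [ffun p => inord `|((B ^+ i) p.1 p.2 %% m.+1)%Z|%N].
have : ~~ injectiveb g.
  by apply/negP=> /injectiveP /leq_card; rewrite card_ord ltnn.
case/injectivePn=> i [j ij]; wlog lt_ij : i j ij / (i < j)%N.
  move=> W; have [|le] := ltnP i j; first exact: W.
  move=> e; apply: (W j i); rewrite 1?eq_sym //.
  by rewrite ltn_neqAle le andbT eq_sym.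
move/ffunP=> e; exists (j - i)%N; rewrite ?subn_gt0 // => x.
have e2 p q : ((B ^+ j) p q = (B ^+ i) p q %[mod m.+1])%Z.
  have lt k : (`|((B ^+ k) p q %% m.+1)%Z| < m.+1)%N.
    have := ltz_pmod ((B ^+ k) p q) (isT : 0 < m.+1%:Z).
    by have := modz_ge0 ((B ^+ k) p q) (isT : m.+1%:Z != 0); lia.
  have := e (p, q); rewrite !ffunE /= => /(congr1 val) /=.
  rewrite !inordK // => /(congr1 Posz).
  by rewrite !abszE !ger0_norm ?modz_ge0.
pose y := x *m invmx (B ^+ i).
have -> : x *m B ^+ (j - i) = y *m B ^+ j.
  by rewrite -[in RHS](subnKC (ltnW lt_ij)) exprD mulmxA mulmxKV // unitmx_exp.
have -> : x = y *m B ^+ i by rewrite mulmxKV // unitmx_exp.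
apply/eq_modP.
exists (y *m (\matrix_(p, q) (((B ^+ j) p q - (B ^+ i) p q) %/ m.+1)%Z)).
rewrite scalemxAr -mulmxDr; congr (_ *m _).
apply/matrixP=> p q; rewrite !mxE.
have /eqP := e2 p q; rewrite eqz_mod_dvd => /divzK d.
by rewrite mulrC d addrC subrK.
Qed.

(* The vectors [sum_i d_i e B^i], with [d_i] the binary digits of [t]: if [e] is
   outside the image of the injective map [B], those with [t < 2^n] are pairwise
   incongruent modulo the image of [B^n]. *)
Fixpoint digit_sum B v n (t : nat) : 'rV[int]_s :=
  if n is n'.+1 then (odd t)%:Z *: v + digit_sum B v n' t./2 *m B else 0.

Lemma digit_sum_inj B v n t t' y :
    \det B != 0 -> (forall y', v <> y' *m B) -> (t < 2 ^ n)%N -> (t' < 2 ^ n)%N ->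
  digit_sum B v n t - digit_sum B v n t' = y *m B ^+ n -> t = t'.
Proof.
move=> dB vB; elim: n t t' y => [|n IH] t t' y; first by rewrite expn0; lia.
rewrite expnS => lt lt' /=; set c := digit_sum _ _ _ _; set c' := digit_sum _ _ _ _.
rewrite exprSr mulmxA => e.
have e' : ((odd t)%:Z - (odd t')%:Z) *: v = (y *m B ^+ n - (c - c')) *m B.
  by rewrite mulmxBl -e mulmxBl scalerBl opprD !addrA; apply/rowP=> j; rewrite !mxE; ring.
have eo : odd t = odd t'.
  move: e'; case: (odd t) (odd t') => -[] //=.
    by rewrite subr0 scale1r => /vB.
  rewrite sub0r scaleN1r => /(congr1 -%R); rewrite opprK -mulNmx.
  by move/vB.
(* The lowest digits agree because [v] is outside the image of [B]; injectivity then removes one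
   factor [B]. *)
have {}e : c - c' = y *m B ^+ n.
  move/eqP: e'; rewrite eo subrr scale0r eq_sym; set d := (_ - _) => /eqP d0.
  have : d = 0.
    apply/eqP; apply: contraT => nz; case/negP: dB; apply/det0P; exists d => //.
  by move/eqP; rewrite subr_eq0 eq_sym => /eqP.
have half : t./2 = t'./2 by apply: IH e; lia.
by rewrite -[t]odd_double_half -[t']odd_double_half eo half.
Qed.

(** If the determinant vanishes, a nonzero [l] with [B *m l^T = 0] kills the image of [B ^+ n], and
    pairing with [l] separates multiples of a basis vector. Otherwise digit sums give [2 ^ n]
    classes. *)
Lemma incongruent_family B M :
    ~ (\det B = 1 \/ \det B = -1) ->
  exists n0, forall n, (n0 <= n)%N -> exists2 m, (0 < m)%N &
    exists f : 'I_M -> 'rV[int]_s, forall i j y z,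
      f i - f j = y *m B ^+ n + m%:Z *: z -> i = j.
Proof.
move=> nu; have [d0|dn0] := eqVneq (\det B) 0.
  have /eqP := d0; rewrite -det_tr => /det0P [l lnz lB].
  have [k lk] : exists k, l 0 k != 0.
    apply/existsP; apply: contraNT lnz => /existsPn l0.
    by apply/eqP/rowP=> k; rewrite mxE; apply/eqP; have := l0 k; rewrite negbK.
  have {}lB : B *m l^T = 0 by rewrite -[B]trmxK -trmx_mul lB trmx0.
  exists 1 => -[//|n] _; exists (M * `|l 0 k|).+1 => //.
  exists (fun t => (t : nat)%:Z *: delta_mx 0 k) => i j y z.
  move/(congr1 (fun x => (x *m l^T) 0 0)).
  rewrite -scalerBl mulmxDl exprSr -!mulmxA lB !mulmx0 add0r -!scalemxAl.
  rewrite [X in _ = X]mxE [X in X = _]mxE -rowE !mxE => e.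
  apply/val_inj => /=; move: e; set q := (\sum_ _ _); clearbody q.
  have := ltn_ord i; have := ltn_ord j; move: (l 0 k) lk => c.
  move: (nat_of_ord i) (nat_of_ord j) => a b cn ltb lta e.
  have [q0|qn] := eqVneq q 0.
    move: e; rewrite q0 mulr0 => /eqP; rewrite mulf_eq0 (negbTE cn) orbF; lia.
  have : (`|((a%:Z - b%:Z) * c)%R| < (M * `|c|).+1)%N.
    rewrite abszM ltnS leq_mul2r; lia.
  by rewrite e abszM ltnNge leq_pmulr // absz_gt0.
have [v vB] : exists v, forall y, v <> y *m B.
  apply: NNPP => nv; apply: nu; apply: unitmx_det.
  have /fin_all_exists [g gB] : forall i : 'I_s, exists y : 'rV_s, delta_mx 0 i = y *m B.
    move=> i; apply: NNPP => ni; apply: nv; exists (delta_mx 0 i) => y e.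
    by apply: ni; exists y.
  have : (\matrix_i g i) *m B = 1%:M.
    by apply/row_matrixP=> i; rewrite row_mul rowK -gB row1.
  by case/mulmx1_unit.
(* With this modulus the term [m%:Z *: z] is absorbed by the image of [B ^+ n]. *)
exists M => n leMn; exists `|\det (B ^+ n)|%N.
  rewrite absz_gt0; elim: {leMn}n => [|n IH]; rewrite ?det1 // exprS.
  by rewrite det_mulmx mulf_neq0.
exists (fun t => digit_sum B v n t) => i j y z.
have [y' ->] := absdet_image (B ^+ n) z.
rewrite -mulmxDl => /digit_sum_inj e; apply/val_inj/e => //.
  by have := ltn_ord i; have := ltn_expl n (isT : (1 < 2)%N); lia.
by have := ltn_ord j; have := ltn_expl n (isT : (1 < 2)%N); lia.
Qed.

(** Lifting the standard basis modulo 2 gives a matrix [A] with rows in [H] and odd determinant. So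
    [H] contains all multiples of [\det A], and surjectivity modulo that determinant finishes. *)
Lemma subgroup_full (H : 'rV[int]_s -> Prop) :
    H 0 -> (forall x y, H x -> H y -> H (x - y)) ->
    (forall m, (0 < m)%N -> forall v, exists2 x, H x & eq_mod m x v) ->
  forall v, H v.
Proof.
move=> H0 HB Hm.
have HN x : H x -> H (- x) by move=> Hx; rewrite -sub0r; apply: HB.
have HD x y : H x -> H y -> H (x + y) by move=> Hx /HN Hy; rewrite -[y]opprK; apply: HB.
have HMn x n : H x -> H (x *+ n) by move=> Hx; elim: n => // n IH; rewrite mulrS; apply: HD.
have HZ x (c : int) : H x -> H (c *: x).
  move=> Hx; case: c => n; first by rewrite -[Posz n]natz scaler_nat; apply: HMn.
  by rewrite NegzE scaleNr -[Posz _]natz scaler_nat; apply/HN/HMn.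
have /fin_all_exists2 [h hH hmod] := fun i : 'I_s => Hm 2 isT (delta_mx 0 i).
pose A := \matrix_i h i.
have HA y : H (y *m A).
  rewrite mulmx_sum_row; elim/big_ind: _ => // i _; rewrite rowK; exact: HZ.
have dA : \det A != 0.
  have : (\det A)%:~R != 0 :> 'F_2.
    rewrite -det_map_mx /=.
    have -> : map_mx intr A = 1%:M :> 'M['F_2]_s.
      apply/matrixP=> i j; rewrite !mxE.
      have /eq_modP [z ->] := hmod i; rewrite !mxE rmorphD rmorphM /= .
      have -> : (2%:Z)%:~R = 0 :> 'F_2 by apply/eqP.
      by rewrite mul0r addr0 /= eq_sym; case: (i == j).
    by rewrite det1 oner_eq0.
  by apply: contraNneq => ->.
move=> v; have [] := Hm `|\det A|%N _ v; first by rewrite absz_gt0.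
move=> x Hx /eq_modP [z]; have [y ->] := absdet_image A z.
by move=> e; have -> : v = x - y *m A; [rewrite e addrK | apply: HB].
Qed.

End IntegerMatrices.

(** * The fixed point of the morphism and its cutting points *)

Section GeneratedWords.
Variables (s : nat) (phi : seq 'I_s -> seq 'I_s) (w : nat -> 'I_s).
Hypotheses (phi_morph : is_morphism phi) (w_gen : generated_by phi w).
Implicit Types (u x y : seq 'I_s) (i j k n N : nat).

Local Notation B := (incidence_mx phi)^T.
Local Notation pre n := (slice w 0 n).
Local Notation P n x := (iter n phi x).
Local Notation L n := (size (P n [:: w 0])).
Local Notation pos n k := (size (P n (pre k))).

Lemma size_slice i j : size (slice w i j) = (j - i)%N.
Proof. by rewrite size_map size_iota. Qed.

Lemma slice_cat i j k : (i <= j <= k)%N ->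
  slice w i k = slice w i j ++ slice w j k.
Proof.
case/andP=> ij jk; rewrite /slice -map_cat /index_iota.
by rewrite -[in iota j _](subnKC ij) -iotaD; congr (map _ (iota _ _)); lia.
Qed.

Lemma slice1 i : slice w i i.+1 = [:: w i].
Proof. by rewrite /slice /index_iota subSnn. Qed.

Lemma slice_eqP i j n :
  slice w i (i + n) = slice w j (j + n) <->
  forall t, (t < n)%N -> w (i + t) = w (j + t).
Proof.
have nth_slice k t : (t < n)%N -> nth (w 0) (slice w k (k + n)) t = w (k + t).
  move=> lt; rewrite (nth_map 0) ?size_iota ?addKn // nth_iota //.
  by rewrite addKn.
split=> [e t lt | e].
  by rewrite -nth_slice // e nth_slice.
apply: (eq_from_nth (x0 := w 0)); rewrite !size_slice !addKn // => t lt.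
by rewrite !nth_slice //; apply: e.
Qed.

Lemma occurs1 a i : occurs_at w [:: a] i <-> w i = a.
Proof. by rewrite /occurs_at addn1 slice1; split=> [[]|->]. Qed.

Lemma parikh_cat x y : parikh (x ++ y) = parikh x + parikh y.
Proof. by apply/rowP=> j; rewrite !mxE count_cat PoszD. Qed.

Lemma phi_nil : phi [::] = [::].
Proof.
have := phi_morph.1 [::] [::]; rewrite /= => /(congr1 size).
by rewrite size_cat; case: (phi [::]) => //= a l; lia.
Qed.

Lemma parikh_phi x : parikh (phi x) = parikh x *m B.
Proof.
elim: x => [|a x IH].
  rewrite phi_nil; have -> : parikh [::] = 0 :> 'rV[int]_s.
    by apply/rowP=> j; rewrite !mxE.
  by rewrite mul0mx.
rewrite -cat1s phi_morph.1 !parikh_cat IH mulmxDl; congr (_ + _).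
have -> : parikh [:: a] = delta_mx 0 a :> 'rV[int]_s.
  by apply/rowP=> j; rewrite !mxE /= [j == a]eq_sym; case: (a == j).
by rewrite -rowE; apply/rowP=> j; rewrite !mxE.
Qed.

Lemma parikh_iter n x : parikh (P n x) = parikh x *m B ^+ n.
Proof.
elim: n => [|n IH]; first by rewrite mulmx1.
by rewrite /= parikh_phi IH exprSr mulmxA.
Qed.

Lemma iter_nil n : P n [::] = [::].
Proof. by elim: n => //= n ->; rewrite phi_nil. Qed.

Lemma iter_cat n x y : P n (x ++ y) = P n x ++ P n y.
Proof. by elim: n => //= n ->; rewrite phi_morph.1. Qed.

Lemma leq_size_iter n x : (size x <= size (P n x))%N.
Proof.
elim: n => //= n IH; apply: leq_trans IH _; move: (P n x) => {x}.
elim=> //= a x IH; rewrite -cat1s phi_morph.1 size_cat.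
have := phi_morph.2 a; case: (phi [:: a]) => //= b l _; lia.
Qed.

Lemma generated_at0 :
  (exists2 t, phi [:: w 0] = w 0 :: t & t <> [::]) /\
  word_lim (fun n => P n [:: w 0]) w.
Proof.
case: w_gen => a [t [e tn lim]]; have [N /(_ _ (leqnn N))] := lim 1.
have [l ->] : exists l, P N [:: a] = a :: l.
  elim: N => [|N [l IH]]; first by exists [::].
  by exists (t ++ phi l); rewrite /= IH -cat1s phi_morph.1 e.
rewrite slice1 prefix_cons => /andP[/eqP -> _].
by split=> //; exists t.
Qed.

(** A prefix of [w] is a prefix of some iterate on [w 0], so its image is a prefix of a later
    iterate. Thus [pos n k] is where the image of the letter [w k] starts. *)
Lemma iter_pre n k : P n (pre k) = pre (pos n k).
Proof.
have [N1 h1] := generated_at0.2 (pos n k); have [N2 h2] := generated_at0.2 k.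
have /prefixP [z] := h2 (maxn N1 N2) (leq_maxr _ _).
move/(congr1 (iter n phi)); rewrite -iterD iter_cat => e.
have le : (N1 <= n + maxn N1 N2)%N by lia.
have := h1 _ le; rewrite e prefixE size_slice subn0 take_size_cat // => /eqP.
by [].
Qed.

Lemma iter_at0 n : P n [:: w 0] = pre (L n).
Proof. by have := iter_pre n 1; rewrite slice1. Qed.

Lemma leq_L n : (n < L n)%N.
Proof.
elim: n => // n IH; have [t e tn] := generated_at0.1.
rewrite iterSr e -cat1s iter_cat size_cat.
have : (0 < size t)%N by case: t tn {e}.
by have := leq_size_iter n t; lia.
Qed.

Lemma pos0 n : pos n 0 = 0%N.
Proof. by rewrite iter_nil. Qed.

Lemma posS n k : pos n k.+1 = (pos n k + size (P n [:: w k]))%N.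
Proof. by rewrite (slice_cat (j := k)) ?leqnSn // iter_cat size_cat slice1. Qed.

Lemma pos_pos n m k : pos n (pos m k) = pos (n + m) k.
Proof. by rewrite -iter_pre iterD. Qed.

Lemma iter_block n k : slice w (pos n k) (pos n k.+1) = P n [:: w k].
Proof.
set p := pos n k; set q := pos n k.+1.
have e : pre p ++ P n [:: w k] = pre p ++ slice w p q.
  rewrite -slice_cat /p /q ?posS ?leq_addr // -posS -!iter_pre -iter_cat.
  by rewrite (slice_cat (i := 0) (j := k) (k := k.+1)) ?leqnSn // slice1.
by move/eqP: e; rewrite eqseq_cat // => /andP[_ /eqP].
Qed.

Lemma parikh_pos n k : parikh (pre (pos n k)) = parikh (pre k) *m B ^+ n.
Proof. by rewrite -iter_pre parikh_iter. Qed.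

Lemma parikh_pre_add i j :
  parikh (pre (i + j)) = parikh (pre i) + parikh (slice w i (i + j)).
Proof. by rewrite -parikh_cat -slice_cat ?leq_addr. Qed.

Lemma block_start n k t : w k = w 0 -> (t < L n)%N -> w (pos n k + t) = w t.
Proof.
move=> wk lt; have := iter_block n k; rewrite posS wk [in RHS]iter_at0 -[in RHS](add0n (L n)).
by move/slice_eqP; apply.
Qed.

Lemma parikh_block_start n k t : w k = w 0 -> (t <= L n)%N ->
  parikh (pre (pos n k + t)) = parikh (pre k) *m B ^+ n + parikh (pre t).
Proof.
move=> wk le; rewrite parikh_pre_add parikh_pos -[in RHS](add0n t).
congr (_ + parikh _); apply/slice_eqP => r lt.
by apply: block_start => //; apply: leq_trans le.
Qed.

Lemma occurs_block_start n k u i : w k = w 0 -> (i + size u <= L n)%N ->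
  occurs_at w u i -> occurs_at w u (pos n k + i).
Proof.
move=> wk le ui; rewrite /occurs_at -[RHS]ui.
apply/slice_eqP => t lt; rewrite -addnA; apply: block_start => //; lia.
Qed.

Lemma exists_block n i : exists2 k, (pos n k <= i)%N & (i < pos n k.+1)%N.
Proof.
elim: i => [|i [k le lt]].
  exists 0%N; first by rewrite pos0.
  by rewrite posS pos0 add0n; apply: leq_ltn_trans (leq_L n).
have [lt'|le'] := ltnP i.+1 (pos n k.+1); first by exists k => //; lia.
exists k.+1 => //; rewrite posS.
by have := leq_size_iter n [:: w k.+1]; move=> /=; lia.
Qed.

(** * From unimodularity and generating returns to WELLDOC *)

Lemma welldoc_of_returns :
    \det (incidence_mx phi) = 1 \/ \det (incidence_mx phi) = -1 ->
    generates (fun x : 'rV[int]_s =>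
      exists2 r, is_return w [:: w 0] r & x = parikh r) ->
  welldoc w.
Proof.
rewrite -det_tr => /det_unitmx uB gen.
have full m v : (0 < m)%N ->
  exists2 k, w k = w 0 & eq_mod m (parikh (pre k)) v.
  move=> m0; pose H v := exists2 k, w k = w 0 & eq_mod m (parikh (pre k)) v.
  have pre0 : parikh (pre 0) = 0 by apply/rowP=> j; rewrite !mxE.
  have H0 : H 0 by exists 0%N => //; rewrite pre0.
  have HD (x y : 'rV_s) : H x -> H y -> H (x + y).
    case=> i wi xi [j wj yj]; have [n n0 nB] := mod_order m0 uB.
    have nkB k z : eq_mod m (z *m B ^+ (n * k)) z.
      elim: k z => [|k IH] z; first by rewrite muln0 mulmx1.
      by move=> l; rewrite mulnS exprD mulmxA IH; apply: nB.
    (* The exponent is a multiple of [n], so the power of [B] acts trivially modulo [m], and is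
       large enough that position [j] lies inside the block. *)
    exists (pos (n * j) i + j)%N.
      by rewrite block_start //; have := leq_L (n * j); nia.
    rewrite parikh_block_start //; last by have := leq_L (n * j); nia.
    have [/eq_modP [a ->] /eq_modP [b ->]] := (xi, yj).
    have /eq_modP [c ->] := nkB j (x + m%:Z *: a).
    apply/eq_modP; exists (a + b + c); rewrite !scalerDr.
    by apply/rowP=> l; rewrite !mxE; ring.
  have HMn (x : 'rV_s) n : H x -> H (x *+ n).
    by move=> Hx; elim: n => // n IH; rewrite mulrS; apply: HD.
  (* Modulo [m], [- x] is [x *+ m.-1]. *)
  have HN (x : 'rV_s) : H x -> H (- x).
    move=> /(HMn _ m.-1) [k wk /eq_modP [z e]]; exists k => //; apply/eq_modP.
    exists (x + z); rewrite e scalerDr -[Posz m]natz !scaler_nat -[in x *+ m](prednK m0).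
    by rewrite mulrS !addrA addNr add0r.
  apply: (gen H) => // [x y Hx Hy | x [r [i [j [ij wi wj _ ->]]] ->]].
    by apply: HD => //; apply: HN.
  have -> : parikh (slice w i j) = parikh (pre j) - parikh (pre i).
    by rewrite -(subnKC (ltnW ij)) parikh_pre_add addrC addKr.
  apply: HD; first by exists j => //; apply/occurs1.
  by apply: HN; exists i => //; apply/occurs1.
(* Since [N <= L N], the occurrence of [u] at [i] lies in the [N]-th iterate of [w 0], hence recurs
   in each block coming from [w 0]. *)
move=> m u m0 [i ui] v; set N := (i + size u)%N.
have le : (N <= L N)%N by apply/ltnW/leq_L.
have [k wk /eq_modP [z e]] := full m ((v - parikh (pre i)) *m invmx (B ^+ N)) m0.
exists (parikh (pre (pos N k + i))).
  by exists (pos N k + i)%N => //; apply: occurs_block_start.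
rewrite parikh_block_start //; last by lia.
apply/eq_modP; exists (z *m B ^+ N).
by rewrite e mulmxDl mulmxKV ?unitmx_exp // scalemxAl addrAC subrK.
Qed.

(** * From WELLDOC to generating returns *)

Lemma returns_of_welldoc : welldoc w ->
  generates (fun x : 'rV[int]_s =>
    exists2 r, is_return w [:: w 0] r & x = parikh r).
Proof.
move=> wd H H0 HB Hret.
have HD (x y : 'rV_s) : H x -> H y -> H (x + y).
  by move=> Hx Hy; rewrite -[y]opprK -[- y]sub0r; apply/HB/HB.
(* Cutting at the previous occurrence of [w 0] leaves a shorter such prefix and one return. *)
have tele i : w i = w 0 -> H (parikh (pre i)).
  elim/ltn_ind: i => -[|i] IH wi.
    suff -> : parikh (pre 0) = 0 by [].
    by apply/rowP=> j; rewrite !mxE.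
  pose Q j := (j <= i)%N && (w j == w 0).
  have exQ : exists j, Q j by exists 0%N; apply/andP.
  have leQ j : Q j -> (j <= i)%N by case/andP.
  case: (ex_maxnP exQ leQ) => j /andP[ji /eqP wj] jmax.
  rewrite -[i.+1](subnKC (leqW ji)) parikh_pre_add subnKC ?leqW //.
  apply: HD; first exact: IH.
  apply: Hret; exists (slice w j i.+1) => //; exists j, i.+1; split=> //.
  - exact/occurs1.
  - exact/occurs1.
  move=> k /andP[jk ki] /occurs1 wk.
  have /jmax : Q k by rewrite /Q wk eqxx andbT.
lia.
apply: subgroup_full => // m m0 v.
have [|x [i /occurs1 wi ->] xv] := wd m [:: w 0] m0 _ v.
  by exists 0%N; apply/occurs1.
by exists (parikh (pre i)) => //; apply: tele.
Qed.

(** * Block lengths and synchronization under WELLDOC *)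

Lemma welldoc_count b R : welldoc w ->
  exists2 k, w k = w 0 & (R <= count_mem b (pre k))%N.
Proof.
(* A count congruent to [R] modulo [R.+1] is at least [R]. *)
move=> /(_ R.+1 [:: w 0] isT) wd.
have [|_ [k /occurs1 wk ->] /(_ b)] := wd _ (\row__ R%:Z).
  by exists 0%N; apply/occurs1.
rewrite !mxE !modz_nat => -[e]; exists k => //.
by rewrite -[X in (X <= _)%N](modn_small (ltnSn R)) -e leq_mod.
Qed.

Lemma leq_size_sum m x :
  (size (P m x) <= (\sum_b size (P m [:: b])) * size x)%N.
Proof.
elim: x => [|b x IH]; first by rewrite iter_nil.
rewrite -cat1s iter_cat !size_cat mulnDr leq_add // muln1.
by rewrite (bigD1 b) //= leq_addr.
Qed.

Lemma leq_size_mem n b x : b \in x -> (size (P n [:: b]) <= size (P n x))%N.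
Proof.
case/splitPr=> y z; rewrite iter_cat -(cat1s b z) iter_cat !size_cat; lia.
Qed.

Lemma leq_count_size n b x :
  (count_mem b x * size (P n [:: b]) <= size (P n x))%N.
Proof.
elim: x => [|c x IH] //; rewrite -cat1s iter_cat count_cat size_cat mulnDl leq_add //=.
by case: eqVneq => [->|]; rewrite ?mul1n.
Qed.

Lemma leq_pos n k k' : (k <= k')%N -> (pos n k <= pos n k')%N.
Proof.
move=> le; rewrite (slice_cat (j := k) (k := k')) // iter_cat size_cat.
exact: leq_addr.
Qed.

Lemma mem_slice i j b :
  b \in slice w i j -> exists2 k, (i <= k < j)%N & w k = b.
Proof. by case/mapP=> k; rewrite mem_index_iota => k_ij ->; exists k. Qed.

Lemma slice_mem i j k : (i <= k < j)%N -> w k \in slice w i j.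
Proof. by move=> k_ij; apply: map_f; rewrite mem_index_iota. Qed.

(** Under WELLDOC every letter occurs in one fixed iterate [P m [:: w 0]], so its [n]-th image is no
    longer than [P m] of [P n [:: w 0]]. *)
Lemma size_iter_letter : welldoc w ->
  exists C, forall n b, (size (P n [:: b]) <= C * L n)%N.
Proof.
move=> wd.
have /fin_all_exists [k kP] : forall b, exists k, b \in pre k.
  move=> b; have [k _] := welldoc_count b 1 wd.
  by rewrite -has_count has_pred1; exists k.
pose m := \max_b k b; exists (\sum_b size (P m [:: b]))%N => n b.
apply: leq_trans (leq_size_sum m _); rewrite -iterD addnC iterD.
apply: leq_size_mem; rewrite iter_at0.
have /mem_slice [i /andP[_ lt] <-] := kP b; apply: slice_mem.
have := leq_L m; have := leq_bigmax (F := k) b; rewrite -/m; lia.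
Qed.

Lemma mem_iter0 k x : w 0 \in x -> w 0 \in P k x.
Proof.
move=> x0; elim: k => //= k; have [t e _] := generated_at0.1.
by case/splitPr=> y z; rewrite -(cat1s (w 0) z) !phi_morph.1 e !mem_cat inE eqxx orbT.
Qed.

(** The image of [w 0] contains [w 0], so once [w 0] appears among the iterates of a letter it
    persists; a maximum over letters suffices. *)
Lemma uniform_return : exists K, forall b k,
  w 0 \in P k [:: b] -> w 0 \in P K [:: b].
Proof.
have /fin_all_exists [K KP] : forall b : 'I_s, exists K, forall k,
    w 0 \in P k [:: b] -> w 0 \in P K [:: b].
  move=> b; have [[K bK]|nb] := classic (exists K, w 0 \in P K [:: b]).
    by exists K.
  by exists 0%N => k bk; case: nb; exists k.
exists (\max_b K b) => b k /KP bK.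
by rewrite -(subnK (leq_bigmax (F := K) b)) iterD mem_iter0.
Qed.

(* A letter [w 0] of [w] only arises from a letter whose blocks under
   [phi^(N+K)] contain [phi^N (w 0)] and have length comparable with [L N]; this
   makes the cutting points visible, up to bounded ambiguity, in a prefix of
   length [O(L N)], without any primitivity assumption. *)
Lemma aligned_block : welldoc w -> exists D, forall N, exists Q,
  (Q <= D * L N)%N /\
  forall i, occurs_at w (pre Q) i -> exists k t,
    [/\ w k = w 0, pos N k = (i + t)%N & (t + L N <= Q)%N].
Proof.
move=> wd; have [C CP] := size_iter_letter wd; have [K KP] := uniform_return.
pose C1 := (\sum_b size (P K [:: b]))%N.
have LK N : (L (N + K) <= C1 * L N)%N by rewrite addnC iterD leq_size_sum.
(* Enough copies of [w 0] precede [k1] that [p] is at least the maximal length [C * L (N + K)] of a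
   block of level [N + K]; [Q] leaves the same room after [p]. *)
have [k1 wk1 ck1] := welldoc_count (w 0) (C * C1) wd.
exists (k1 * C + C * C1)%N => N; pose p := pos N k1.
have lep : (C * L (N + K) <= p)%N.
  apply: leq_trans (leq_count_size N (w 0) _).
  apply: leq_trans (leq_mul ck1 (leqnn _)); rewrite -mulnA leq_mul //.
have lep' : (p <= k1 * C * L N)%N.
  rewrite /p; elim: (k1) => [|k IH]; first by rewrite pos0.
  by rewrite posS mulSn mulnDl addnC leq_add.
exists (p + C * L (N + K))%N; split.
  by rewrite mulnDl leq_add // -mulnA leq_mul.
move=> i; rewrite /occurs_at size_slice subn0 -[X in _ = slice w 0 X]add0n.
move/slice_eqP => occ.
have L0 := leq_L (N + K); have C0 := CP (N + K)%N (w 0).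
have wip : w (i + p) = w 0.
  rewrite occ; last by nia.
  by rewrite /p -[pos N k1]addn0 block_start //; apply: leq_ltn_trans (leq_L N).
(* This block contains [w 0], so [K] iterations of its source letter produce [w 0]; the [N]-th image
   of that copy stays inside the window of length [Q]. *)
have [k' le' lt'] := exists_block (N + K) (i + p).
have bK : w 0 \in P K [:: w k'].
  apply: (KP _ (N + K)%N); rewrite -iter_block -wip; apply: slice_mem.
  by rewrite le'.
rewrite -iter_block in bK; have [k /andP[kl kr] wk] := mem_slice bK.
have {kl} := leq_pos N kl; rewrite pos_pos => kl.
have {kr} := leq_pos N kr; rewrite pos_pos !posS wk => kr.
have Ck := CP (N + K)%N (w k').
exists k, (pos N k - i)%N; split=> //; move: lt'; rewrite posS; lia.
Qed.

(** * Short periods and the contradiction with periodicity *)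

Lemma short_periods : welldoc w ->
    ~ (\det (incidence_mx phi) = 1 \/ \det (incidence_mx phi) = -1) ->
  forall T, (0 < T)%N -> exists N0, forall N, (N0 <= N)%N ->
    exists p, [/\ (0 < p)%N, (p * T <= L N)%N &
      forall t, (t + p < L N)%N -> w t = w (t + p)].
Proof.
move=> wd; rewrite -det_tr => nu T T0; have [D DP] := aligned_block wd.
(* Positions up to [Q] fall into at most [T * D + 1] bins of width [L N / T]; one more class forces
   a collision. *)
have [N0 N0P] := incongruent_family (T * D).+2 nu; exists N0 => N /N0P.
case=> m m0 [f f_inj]; have [Q [QD QP]] := DP N.
have /fin_all_exists [g gP] : forall c, exists t, [/\ (t <= Q)%N,
    forall r, (r < L N)%N -> w (t + r) = w r &
    exists y z : 'rV_s, f c = y *m B ^+ N - parikh (pre t) + m%:Z *: z].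
  move=> c; have [|x [i occ ->] /eq_modP [z e]] := wd m (pre Q) m0 _ (f c).
    by exists 0%N; rewrite /occurs_at size_slice subn0.
  have [k [t [wk kt tQ]]] := QP i occ.
  move: occ; rewrite /occurs_at size_slice subn0 -[X in _ = slice w 0 X]add0n.
  move/slice_eqP => occ; exists t; split; first by lia.
    move=> r lt; rewrite -(block_start wk lt) kt -addnA occ //; lia.
  exists (parikh (pre k)), (- z).
  have e2 : parikh (slice w i (i + t)) = parikh (pre t).
    congr parikh; rewrite -[X in _ = slice w 0 X]add0n; apply/slice_eqP => r lt.
    by apply: occ; lia.
  by rewrite -parikh_pos kt parikh_pre_add e2 addrK e scalerN addrK.
have L0 : (0 < L N)%N by apply: leq_ltn_trans (leq_L N).
have bd c : (g c * T %/ L N < (T * D).+1)%N.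
  have [le _ _] := gP c; rewrite ltnS -[X in (_ <= X)%N](mulnK _ L0) leq_div2r //.
  by rewrite mulnC -mulnA leq_mul //; apply: leq_trans QD.
have : ~~ injectiveb (fun c => Ordinal (bd c)).
  by apply/negP=> /injectiveP /leq_card; rewrite !card_ord ltnn.
case/injectivePn=> c [c' cc' /(congr1 val) /= e].
wlog lt : c c' cc' e / (g c < g c')%N.
  move=> W; case: (ltngtP (g c) (g c')) => [||eg].
  - exact: W.
  - by apply: W => //; rewrite eq_sym.
  (* Equal positions would make [f c] and [f c'] congruent. *)
  have [[_ _ [y [z fc]]] [_ _ [y' [z' fc']]]] := (gP c, gP c').
  case/eqP: cc'; apply: (f_inj _ _ (y - y') (z - z')).
  rewrite fc fc' eg mulmxBl scalerBr; apply/rowP=> l; rewrite !mxE; ring.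
have [_ gc _] := gP c; have [_ gc' _] := gP c'.
exists (g c' - g c)%N; split=> [||t lt']; first by rewrite subn_gt0.
  have := divn_eq (g c * T) (L N); have := divn_eq (g c' * T) (L N).
  by have := ltn_pmod (g c' * T) L0; rewrite e mulnBl; lia.
rewrite -(gc' t); last by lia.
rewrite -(gc (t + (g c' - g c))%N) //.
by congr w; lia.
Qed.

(** In the spirit of Fine and Wilf: lower [x] by [q] until it is below [q]; then [x + p] is still
    below [l], and steps of [q] lead down to [y]. *)
Lemma two_periods (p q l x y v : nat) : (p + q <= l)%N ->
    (forall t, (t + p < l)%N -> w t = w (t + p)) ->
    (forall t, (t + q < l)%N -> w t = w (t + q)) ->
    (x < l)%N -> (y < l)%N -> (x + p = y + v * q)%N -> w x = w y.
Proof.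
move=> pql pp pq; elim: v x => [|v IH] x xl yl e.
  by rewrite pp; [congr w; lia | lia].
have [qx|xq] := leqP q x.
  rewrite -[x in LHS](subnK qx) -pq ?subnK //.
  by apply: IH => //; [lia | move: e; rewrite mulSn; lia].
have step d : (y + d * q < l)%N -> w y = w (y + d * q).
  elim: d => [|d IHd]; first by rewrite addn0.
  rewrite mulSn => lt; rewrite IHd; last by lia.
  by rewrite pq; [congr w; lia | lia].
by rewrite pp ?e -?step //; lia.
Qed.

Lemma periodic_of_short_periods :
    (forall T, (0 < T)%N -> exists N0, forall N, (N0 <= N)%N ->
      exists p, [/\ (0 < p)%N, (p * T <= L N)%N &
        forall t, (t + p < L N)%N -> w t = w (t + p)]) ->
  exists2 p, (0 < p)%N & forall t, w t = w (t + p).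
Proof.
pose C := (\sum_b size (P 1 [:: b]))%N.
have LS N : (L N.+1 <= C * L N)%N by rewrite (leq_size_sum 1).
(* With [C.+1], the bounds on [p] and on the next period [q] add up to [p + q <= L M]. *)
move=> /(_ C.+1 isT) [N0 N0P]; have [p [p0 pT pp]] := N0P N0 (leqnn _).
have Lmono N : (L N0 <= L (N0 + N))%N by rewrite addnC iterD leq_size_iter.
exists p => // t.
suff per N r : (r + p < L (N0 + N))%N -> w r = w (r + p).
  by apply: (per (t + p)%N); have := leq_L (N0 + (t + p)); lia.
elim: N r => [|N IH] r; first by rewrite addn0; apply: pp.
rewrite addnS; set M := (N0 + N)%N => lt.
have [q [q0 qT qq]] := N0P M.+1 ltac:(lia).
have pql : (p + q <= L M)%N.
  have : ((p + q) * C.+1 <= L M * C.+1)%N.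
    by have := Lmono N; have := LS M; rewrite -/M mulnDl mulnS; lia.
  by rewrite leq_mul2r.
(* Reduction modulo [q] brings [r] and [r + p] into the prefix of length [L M], where [p] is already
   a period. *)
have red k : (k < L M.+1)%N -> w k = w (k %% q).
  rewrite {1 2}(divn_eq k q) addnC; elim: (k %/ q)%N => [|d IHd]; first by rewrite addn0.
  rewrite mulSn [X in (_ + X)%N]addnC addnA => lt'.
  by rewrite -qq // IHd //; lia.
rewrite (red r) ?(leq_ltn_trans (leq_addr p r)) // (red (r + p)%N) //.
have mq z : (z %% q < L M)%N by have := ltn_pmod z q0; lia.
apply: (two_periods (v := ((r %% q + p) %/ q)%N) pql) => //.
  by move=> d ld; apply/qq/(leq_trans ld)/(leq_size_iter 1).
by rewrite [RHS]addnC -(modnDml r p q) -divn_eq.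
Qed.

(** With period [p], the Parikh vector of [pre k] modulo [p.+1] depends only on [k %% p] and on
    [k %/ p] modulo [p.+1]: at most [p * p.+1] classes, fewer than the [p.+1 ^ 2] supported on two
    letters. *)
Lemma welldoc_aperiodic p : (1 < s)%N -> welldoc w -> (0 < p)%N ->
  ~ (forall t, w t = w (t + p)).
Proof.
move=> s1 wd p0 per; pose a := Ordinal (ltnW s1); pose b := Ordinal s1.
pose v (c : 'I_p.+1 * 'I_p.+1) : 'rV[int]_s :=
  (c.1 : nat)%:Z *: delta_mx 0 a + (c.2 : nat)%:Z *: delta_mx 0 b.
have /fin_all_exists [g gP] : forall c, exists k,
    eq_mod p.+1 (parikh (pre k)) (v c).
  move=> c; have [|_ [k _ ->] e] := wd p.+1 [::] isT _ (v c); last by exists k.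
  by exists 0%N; rewrite /occurs_at /slice /= /index_iota.
pose h c := (Ordinal (ltn_pmod (g c %/ p)%N (ltn0Sn p)), Ordinal (ltn_pmod (g c) p0)).
have : ~~ injectiveb h.
  apply/negP=> /injectiveP /leq_card; rewrite !card_prod !card_ord.
  by rewrite leq_mul2l /= ltnn.
case/injectivePn=> c [c' /eqP cc' [e1 e2]]; case: cc'.
have pre_mod k : parikh (pre k) = parikh (pre p) *+ (k %/ p) + parikh (pre (k %% p)).
  rewrite {1}(divn_eq k p); elim: (k %/ p)%N => [|d IH]; first by rewrite add0n mulr0n add0r.
  rewrite mulSn -addnA parikh_pre_add mulrS -addrA -IH; congr (_ + parikh _).
  rewrite -[X in _ = slice w 0 X]add0n; apply/slice_eqP => t _.
  by rewrite add0n [in RHS]per addnC.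
have ge : eq_mod p.+1 (parikh (pre (g c))) (parikh (pre (g c'))).
  rewrite (pre_mod (g c)) (pre_mod (g c')) e2 => j; rewrite !mxE !mulmxnE !mxE.
  have mulz k : (count_mem j (pre p))%:Z *+ k = (count_mem j (pre p))%:Z * k%:Z.
    by rewrite -mulr_natr natz.
  by rewrite !mulz -modzDml -modzMmr modz_nat e1 -modz_nat modzMmr modzDml.
have {}ge : eq_mod p.+1 (v c) (v c') by move=> l; rewrite -!gP.
have := ge a; have := ge b; rewrite !mxE !eqxx /= !mulr0 !mulr1 !addr0 !add0r.
rewrite !modz_nat !modn_small // => -[v2] [v1].
by case: c c' v1 v2 {e1 e2 ge} => [c1 c2] [c1' c2'] /= /val_inj -> /val_inj ->.
Qed.

Lemma unimodular_of_welldoc : (1 < s)%N -> welldoc w ->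
  \det (incidence_mx phi) = 1 \/ \det (incidence_mx phi) = -1.
Proof.
move=> s1 wd; apply: NNPP => nu.
have [p p0] := periodic_of_short_periods (short_periods wd nu).
exact: welldoc_aperiodic.
Qed.

End GeneratedWords.

Theorem theorem2 (sigma : nat) (sigma_gt1 : (1 < sigma)%N)
    (phi : seq 'I_sigma -> seq 'I_sigma) (w : nat -> 'I_sigma)
    (phi_morph : is_morphism phi) (w_gen : generated_by phi w) :
  welldoc w <->
    (\det (incidence_mx phi) = 1 \/ \det (incidence_mx phi) = -1) /\
    generates (fun x : 'rV[int]_sigma =>
      exists2 r : seq 'I_sigma, is_return w [:: w 0%N] r & x = parikh r).
Proof.
split=> [wd | [detA gen]]; last first.
  exact: (welldoc_of_returns phi_morph w_gen detA gen).
split; first exact: (unimodular_of_welldoc phi_morph w_gen sigma_gt1 wd).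
exact: returns_of_welldoc.
Qed.
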